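(* Let $q\geq 2$, $k\geq 2$ and $t\in\{1,\ldots,k-1\}$ be integers. (i) On every instance of $\mathsf{k\,CSP\!-\!q}$ with strong chromatic number $\nu\geq k$, the average differential ratio is at least $\rho(\nu,q,k)$. (ii) On every instance of $\mathsf{k\,CSP}(\mathcal{E}_q)$ with strong chromatic number $\nu\geq k$, the average differential ratio is at least $\rho_E(\nu,q,k)$. (iii) On every instance of $\mathsf{k\,CSP}(\mathcal{I}_q^t)$ with strong chromatic number $\nu\geq k$, the average differential ratio is at least $\rho(\nu-t,q,\min\{k,\nu-t\})$.
   Context: Let $\Sigma_q=\{0,1,\ldots,q-1\}$, with arithmetic modulo $q$ (componentwise on vectors), and $[n]=\{1,\ldots,n\}$. For $a\in\Sigma_q$, $\mathbf{a}=(a,\ldots,a)$. CSPs. An instance $I$ of $\mathsf{k\,CSP\!-\!q}$ consists of integers $n,m\ge 1$, a goal (maximize or minimize) and, for each $i\in[m]$, a weight $w_i>0$, an integer $1\le k_i\leq \min\{k,n\}$, a strictly increasing sequence $J_i=(i_1,\ldots,i_{k_i})$ of indices of $[n]$, and a function $P_i:\Sigma_q^{k_i}\to\mathbb{R}$. Solutions are vectors $x\in\Sigma_q^n$, with value $v(I,x)=\sum_{i=1}^m w_iP_i(x_{i_1},\ldots,x_{i_{k_i}})$. $\mathrm{opt}(I)$ and $\mathrm{wor}(I)$ are the best and worst solution values (maximum and minimum of $v(I,\cdot)$ if maximizing, minimum and maximum if minimizing). For a family $\mathcal{F}$ of functions, $\mathsf{k\,CSP}(\mathcal{F})$ is the restriction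 to instances with all $P_i\in\mathcal{F}$. The average differential ratio on $I$ is $(\mathbb{E}_X[v(I,X)]-\mathrm{wor}(I))/(\mathrm{opt}(I)-\mathrm{wor}(I))$ with $X$ uniform on $\Sigma_q^n$ (considered when $\mathrm{opt}(I)\neq\mathrm{wor}(I)$). Strong chromatic number: the smallest $\nu$ such that there is a partition of $[n]$ into $\nu$ sets such that each $J_i$ contains at most one index from each set. Function families. For $P:\Sigma_q^h\to\mathbb{R}$, let $r_P=q^{-h}\sum_{y}P(y)$. $P\in\mathcal{E}_q$ iff $P(y+\mathbf{a})=P(y)$ for all $y\in\Sigma_q^h$, $a\in\Sigma_q$. $P\in\mathcal{I}_q^t$ (balanced $t$-wise independent; requires $h\ge t$) iff for all indices $j_1<\cdots<j_t$ in $[h]$ and all $v\in\Sigma_q^t$, $\sum_{y\in\Sigma_q^h:\,(y_{j_1},\ldots,y_{j_t})=v}P(y)/q^{h-t}=r_P$. Arrays. An array with $R$ rows and $\nu$ columns on $\Sigma_q$ is a multiset of $R$ words (rows) of $\Sigma_q^\nu$; $\mu^M(u)$ is the fraction of rows of $M$ equal to $u$. For $t\le\nu$, $M$ is an orthogonal array of strength $t$ with $\nu$ factors if for all columns $j_1<\cdots<j_t$ and all $v\in\Sigma_q^t$, exactly $R/q^t$ rows of $M$ restricted to these columns equal $v$. $M$ is a difference scheme of strength $t$ (based on $(\mathbb{Z}_q,+)$) if for all columns $j_1<\cdots<j_t$ and all $v\in\{0\}\times\Sigma_q^{t-1}$, exactly $R/q^{t-1}$ rows of $M$ restricted to these columns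 lie in $\{v,v+\mathbf{1},\ldots,v+\mathbf{q-1}\}$. For $1\le t\le\nu$: $\rho(\nu,q,t)$ is the largest $\rho$ for which there is an orthogonal array $M$ on $\Sigma_q$ with $\nu$ factors, strength $t$ and $\max_u\mu^M(u)=\rho$. $\rho_E(\nu,q,t)$ is the largest $\rho$ for which there is a difference scheme $M$ with $\nu$ columns, strength $t$ and entries in $\Sigma_q$ with $\max_{v\in\{0\}\times\Sigma_q^{\nu-1}}\sum_{a=0}^{q-1}\mu^M(v+\mathbf{a})=\rho$. *)

(* Defs.v *)
From mathcomp Require Import all_boot all_order all_algebra.
From mathcomp Require Import boolp classical_sets reals.

Set Implicit Arguments.
Unset Strict Implicit.
Unset Printing Implicit Defensive.

Import Order.TTheory GRing.Theory Num.Theory.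

Local Open Scope ring_scope.

(* Vectors over Sigma_q. The ring 'Z_q is the integers modulo q only when     *)
(* 1 < q, which every result below assumes; {ffun _ -> 'Z_q} carries the      *)
(* componentwise addition.                                                    *)
Notation word q n := {ffun 'I_n -> 'Z_q}.

Definition cst_word (q n : nat) (a : 'Z_q) : word q n := [ffun=> a].

Definition increasing (m n : nat) (J : 'I_m -> 'I_n) : Prop :=
  forall i j : 'I_m, (i < j)%N -> (J i < J j)%N.

Definition restrict (q m n : nat) (J : 'I_m -> 'I_n) (x : word q n) :
    word q m :=
  [ffun j => x (J j)].

Variant goal := Maximize | Minimize.

Record instance (R : realType) (q k : nat) : Type := Instance {
  nvars : nat;
  ncons : nat;
  objective : goal;
  weight : 'I_ncons -> R;
  arity : 'I_ncons -> nat;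
  scope : forall i : 'I_ncons, 'I_(arity i) -> 'I_nvars;
  constraint : forall i : 'I_ncons, word q (arity i) -> R;
  nvars_gt0 : (0 < nvars)%N;
  ncons_gt0 : (0 < ncons)%N;
  weight_gt0 : forall i : 'I_ncons, 0 < weight i;
  arity_gt0 : forall i : 'I_ncons, (0 < arity i)%N;
  arity_le : forall i : 'I_ncons, (arity i <= minn k nvars)%N;
  scope_increasing : forall i : 'I_ncons, increasing (@scope i) }.

Arguments scope {R q k} _ i _.
Arguments constraint {R q k} _ i _.

Section CSP.
Variables (R : realType) (q k : nat).
Implicit Types (I : instance R q k).

Definition value I (x : word q (nvars I)) : R :=
  \sum_(i < ncons I) weight i * constraint I i (restrict (scope I i) x).

(* The zero word only serves as the default witness of nonemptiness.          *)
Definition max_value I : R :=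
  value [arg max_(x > (0 : word q (nvars I))) value x]%O.

Definition min_value I : R :=
  value [arg min_(x < (0 : word q (nvars I))) value x]%O.

Definition opt I : R :=
  if objective I is Maximize then max_value I else min_value I.

Definition wor I : R :=
  if objective I is Maximize then min_value I else max_value I.

Definition mean_value I : R :=
  (\sum_(x : word q (nvars I)) value x) / (q ^ nvars I)%:R.

Definition avg_differential_ratio I : R :=
  (mean_value I - wor I) / (opt I - wor I).

Definition strong_coloring I (P : {set {set 'I_(nvars I)}}) : Prop :=
  finset.partition P [set: 'I_(nvars I)] /\
  forall (i : 'I_(ncons I)) (V : {set 'I_(nvars I)}), V \in P ->
    (#|V :&: [set scope I i j | j : 'I_(arity i)]| <= 1)%N.

Definition is_strong_chromatic_number I (nu : nat) : Prop :=
  (exists P : {set {set 'I_(nvars I)}}, strong_coloring P /\ #|P| = nu) /\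
  (forall P : {set {set 'I_(nvars I)}}, strong_coloring P -> (nu <= #|P|)%N).

Definition csp_over (F : forall h : nat, (word q h -> R) -> Prop) I : Prop :=
  forall i : 'I_(ncons I), F (arity i) (constraint I i).

End CSP.

Section Families.
Variables (R : realType) (q : nat).

Definition mean_fun (h : nat) (P : word q h -> R) : R :=
  (\sum_(y : word q h) P y) / (q ^ h)%:R.

Definition family_E (h : nat) (P : word q h -> R) : Prop :=
  forall (y : word q h) (a : 'Z_q), P (y + cst_word h a) = P y.

Definition family_I (t h : nat) (P : word q h -> R) : Prop :=
  (t <= h)%N /\
  forall (J : 'I_t -> 'I_h) (v : word q t), increasing J ->
    (\sum_(y : word q h | restrict J y == v) P y) / (q ^ (h - t))%:R
    = mean_fun P.

End Families.

(* An array is the sequence of its rows; every notion below is invariant      *)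
(* under permutation of the rows, so sequences stand for multisets.           *)
Section Arrays.
Variable q : nat.

Definition array (nu : nat) : Type := seq (word q nu).

Definition freq (nu : nat) (M : array nu) (u : word q nu) : rat :=
  (count_mem u M)%:R / (size M)%:R.

Definition orthogonal_array (t nu : nat) (M : array nu) : Prop :=
  [/\ M <> [::], (t <= nu)%N
    & forall (J : 'I_t -> 'I_nu) (v : word q t), increasing J ->
        (count (fun u : word q nu => restrict J u == v) M * q ^ t = size M)%N].

Definition starts_with0 (n : nat) (v : word q n) : bool :=
  [forall j : 'I_n, (j == 0%N :> nat) ==> (v j == 0)].

Definition shift_class (n : nat) (v : word q n) : pred (word q n) :=
  fun u => [exists a : 'Z_q, u == v + cst_word n a].

Definition difference_scheme (t nu : nat) (M : array nu) : Prop :=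
  [/\ M <> [::], (t <= nu)%N
    & forall (J : 'I_t -> 'I_nu) (v : word q t), increasing J ->
        starts_with0 v ->
        (count (fun u : word q nu => shift_class v (restrict J u)) M
           * q ^ (t - 1) = size M)%N].

Definition max_freq (nu : nat) (M : array nu) : rat :=
  \big[Num.max/0]_(u : word q nu) freq M u.

Definition max_class_freq (nu : nat) (M : array nu) : rat :=
  \big[Num.max/0]_(v : word q nu | starts_with0 v)
    \sum_(a : 'Z_q) freq M (v + cst_word nu a).

End Arrays.

(* Both suprema are attained: see rho_largest and rho_E_largest below.        *)
Definition rho (R : realType) (nu q t : nat) : R :=
  sup [set r | exists2 M : array q nu,
                 orthogonal_array t M & r = ratr (max_freq M)]%classic.

Definition rho_E (R : realType) (nu q t : nat) : R :=
  sup [set r | exists2 M : array q nu,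
                 difference_scheme t M & r = ratr (max_class_freq M)]%classic.

(* A linear objective on the rational points of a polytope of distributions   *)
(* is maximal at one of the finitely many points determined by their support. *)
Section Attained.
Variables (W : finType) (C : Type) (A : C -> pred W) (b : C -> rat).
Variables (E : finType) (Q : pred E) (obj : E -> (W -> rat) -> rat).
Hypothesis objL : forall e s (p d r : W -> rat),
  (forall u, r u = p u + s * d u) -> obj e r = obj e p + s * obj e d.

Let dist (p : {ffun W -> rat}) : Prop :=
  [/\ forall u, 0 <= p u, \sum_u p u = 1
    & forall c, \sum_(u | A c u) p u = b c].

Let supp (p : {ffun W -> rat}) : {set W} := [set u | p u != 0].

Let rigid (p : {ffun W -> rat}) : Prop :=
  forall p', dist p' -> supp p' \subset supp p -> p' = p.

Let shrink e p p2 : dist p -> dist p2 -> supp p2 \subset supp p -> p2 <> p ->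
  exists p', [/\ dist p', supp p' \proper supp p & obj e p <= obj e p'].
Proof.
move=> [p0 p1 pA] [q0 q1 qA] sub neq.
have [d [d1 dA dn0 dsup dobj]] : exists d : {ffun W -> rat},
    [/\ \sum_u d u = 0, forall c, \sum_(u | A c u) d u = 0,
        exists u, d u != 0, forall u, p u = 0 -> d u = 0 & 0 <= obj e d].
  pose d (s : rat) := [ffun u => s * (p2 u - p u)] : {ffun W -> rat}.
  have dP s : s != 0 -> [/\ \sum_u d s u = 0,
      forall c, \sum_(u | A c u) d s u = 0,
      exists u, d s u != 0 & forall u, p u = 0 -> d s u = 0].
    move=> s0; split.
    - under eq_bigr do rewrite ffunE.
      by rewrite -mulr_sumr sumrB p1 q1 subrr mulr0.
    - move=> c; under eq_bigr do rewrite ffunE.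
      by rewrite -mulr_sumr sumrB pA qA subrr mulr0.
    - apply/existsP; apply: contra_notT neq => /existsPn dn.
      apply/ffunP => u; have := dn u; rewrite negbK ffunE mulf_eq0 (negbTE s0).
      by rewrite subr_eq0 => /eqP.
    - move=> u pu; rewrite ffunE pu.
      have : u \notin supp p2.
        by apply: contra_eqN pu => /(fintype.subsetP sub); rewrite inE.
      by rewrite inE negbK => /eqP ->; rewrite subrr mulr0.
  have obj0 : obj e (fun=> 0) = 0.
    have := @objL e 1 (fun=> 0) (fun=> 0) (fun=> 0) (fun _ => ltac:(by rewrite mulr0 addr0)).
    rewrite mul1r => h; apply: (@addrI _ (obj e (fun=> 0))).
    by rewrite -h addr0.
  have objN : obj e (d (-1)) = - obj e (d 1).
    have := @objL e (-1) (fun=> 0) (d 1) (d (-1)).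
    rewrite obj0 add0r mulN1r; apply => u.
    by rewrite !ffunE add0r mul1r.
  have [le0|lt0] := leP 0 (obj e (d 1)).
    by have [? ? ? ?] := dP 1 (oner_neq0 _); exists (d 1).
  have [|? ? ? ?] := dP (-1); first by rewrite oppr_eq0 oner_neq0.
  by exists (d (-1)); split; rewrite // objN oppr_ge0 ltW.
have [u0 du0] : exists u, d u < 0.
  apply/existsP; case: dn0 => w dw; apply: contraNT dw => /existsPn dge.
  have dge0 u : 0 <= d u by rewrite leNgt; exact: dge.
  by have /psumr_eq0P -> // : forall u, predT u -> 0 <= d u by [].
pose rat_ u := p u / - d u.
pose v := [arg min_(u < u0 | d u < 0) rat_ u]%O.
have [dv vmin] : d v < 0 /\ forall u, d u < 0 -> rat_ v <= rat_ u.
  by rewrite /v; case: arg_minP.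
have s0 : 0 <= rat_ v by rewrite divr_ge0 ?p0 // oppr_ge0 ltW.
pose p' := [ffun u => p u + rat_ v * d u] : {ffun W -> rat}.
exists p'; split.
- split.
  + move=> u; rewrite ffunE; have [du|du] := leP 0 (d u).
      by apply: addr_ge0 (p0 u) _; apply: mulr_ge0.
    have := vmin u du; rewrite {2}/rat_ ler_pdivlMr ?oppr_gt0 // mulrN => h.
    by rewrite -lerBlDr sub0r.
  + under eq_bigr do rewrite ffunE.
    by rewrite big_split /= -mulr_sumr p1 d1 mulr0 addr0.
  + move=> c; under eq_bigr do rewrite ffunE.
    by rewrite big_split /= -mulr_sumr pA dA mulr0 addr0.
- rewrite properE; apply/andP; split.
    apply/fintype.subsetP => u; rewrite !inE ffunE; apply: contraNN => /eqP pu.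
    by rewrite pu dsup // mulr0 addr0.
  apply/fintype.subsetPn; exists v; rewrite !inE.
    by apply: contraTN dv => /eqP /dsup ->; rewrite ltxx.
  rewrite ffunE negbK /rat_ invrN mulrN mulNr divfK ?subrr //.
  by rewrite lt_eqF.
- rewrite (@objL e (rat_ v) p d p') => [|u]; last by rewrite ffunE.
  by rewrite lerDl; apply: mulr_ge0 s0 dobj.
Qed.

Let improve e p : dist p -> exists p', [/\ dist p', rigid p' & obj e p <= obj e p'].
Proof.
have [n] := ubnP #|supp p|; elim: n p => // n IH p lepn dp.
case: (pselect (rigid p)) => [?|nr]; first by exists p.
have [p2 [dp2 sub neq]] : exists p2, [/\ dist p2, supp p2 \subset supp p & p2 <> p].
  apply: contrapT => h; apply: nr => p2 dp2 sub; apply: contrapT => neq.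
  by apply: h; exists p2.
have [p3 [dp3 /proper_card lt3 le3]] := shrink e dp dp2 sub neq.
have [|p4 [? ? ?]] := IH p3 _ dp3; first exact: leq_trans lt3 lepn.
by exists p4; split => //; apply: le_trans le3 _.
Qed.

Lemma extremal_point e0 p0 : Q e0 -> dist p0 ->
  exists e p, [/\ Q e, dist p & forall e' p', Q e' -> dist p' -> obj e' p' <= obj e p].
Proof.
move=> Qe0 dp0.
pose good S p := [/\ dist p, rigid p & supp p = S].
pose g S := if pselect (exists p, good S p) is left h then projT1 (cid h) else p0.
have gP p : dist p -> rigid p -> g (supp p) = p.
  move=> dp rp; rewrite /g; case: pselect => [h|[]]; last by exists p.
  by case: cid => q [/= dq rq sq]; apply: rp; rewrite ?sq.
have gd S : dist (g S).
  by rewrite /g; case: pselect => // h; case: cid => q [].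
pose F (x : E * {set W}) := obj x.1 (g x.2).
have [e p] := @arg_maxP _ _ _ (e0, finset.set0) (fun x => Q x.1) F Qe0.
case: e p => e S /= Qe emax; exists e, (g S); split=> // e' p' Qe' dp'.
have [q [dq rq le]] := improve e' dp'; apply: le_trans le _.
by rewrite -{1}(gP q dq rq); apply: (emax (e', supp q)).
Qed.

End Attained.

Lemma realize_dist (W : finType) (p : W -> rat) :
    (forall u, 0 <= p u) -> \sum_u p u = 1 ->
  exists2 M : seq W, M <> [::] &
    forall u, (count_mem u M)%:R / (size M)%:R = p u.
Proof.
move=> p0 p1; pose D := \prod_u denq (p u).
have D0 : 0 < D by apply: prodr_gt0 => u _; exact: denq_gt0.
have cE u : exists n : nat, n%:R = p u * D%:~R.
  rewrite /D (bigD1 u) //= intrM mulrA -numqE.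
  set x := \prod_(_ | _) _; have x0 : 0 <= x by apply: prodr_ge0.
  exists (absz (numq (p u) * x)); rewrite -intrM natr_absz ger0_norm //.
  by rewrite mulr_ge0 // numq_ge0.
have {cE} [c cE] := choice cE.
pose M := flatten [seq nseq (c u) u | u <- enum W].
have cM u : count_mem u M = c u.
  rewrite count_flatten -map_comp sumnE big_map big_enum /= (bigD1 u) //=.
  rewrite count_nseq /= eqxx mul1n big1 ?addn0 // => w wu.
  by rewrite count_nseq /= (negbTE wu).
have sM : (size M)%:R = D%:~R :> rat.
  rewrite size_flatten /shape -map_comp sumnE big_map big_enum /= natr_sum.
  under eq_bigr do rewrite size_nseq cE.
  by rewrite -mulr_suml p1 mul1r.
have Dn0 : D%:~R != 0 :> rat by rewrite intr_eq0 gt_eqF.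
exists M; first by move=> M0; move: Dn0; rewrite -sM M0 eqxx.
by move=> u; rewrite cM sM cE mulfK.
Qed.

Lemma freq_ge0 (q nu : nat) (M : array q nu) u : 0 <= freq M u.
Proof. by rewrite divr_ge0 ?ler0n. Qed.

Lemma sum_freq (q nu : nat) (M : array q nu) (a : pred (word q nu)) :
  \sum_(u | a u) freq M u = (count a M)%:R / (size M)%:R.
Proof.
rewrite -mulr_suml -natr_sum; congr (_%:R / _); elim: M => [|w M IH] /=.
  by rewrite big1.
rewrite big_split /= IH; congr (_ + _)%N.
rewrite big_mkcond (bigD1 w) //= eqxx big1 ?addn0; first by case: (a w).
by move=> u uw; rewrite eq_sym (negbTE uw); case: ifP.
Qed.

Lemma array_extremal (q nu : nat) (C : Type) (A : C -> pred (word q nu))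
    (N : C -> nat) (E : finType) (Q : pred E)
    (obj : E -> (word q nu -> rat) -> rat)
    (ok : array q nu -> Prop) (top : array q nu -> rat) :
  (forall c, (0 < N c)%N) ->
  (forall e s (p d r : word q nu -> rat),
    (forall u, r u = p u + s * d u) -> obj e r = obj e p + s * obj e d) ->
  (forall M, ok M <-> M <> [::] /\ forall c, (count (A c) M * N c = size M)%N) ->
  (forall M, top M = \big[Num.max/0]_(e | Q e) obj e (freq M)) ->
  (exists e, Q e) -> (exists M, ok M) ->
  exists2 M, ok M & forall M', ok M' -> top M' <= top M.
Proof.
move=> N0 objL okP topE [e0 Qe0] [M0 okM0].
pose b c : rat := (N c)%:R^-1.
pose dist (p : {ffun word q nu -> rat}) := [/\ forall u, 0 <= p u, \sum_u p u = 1
    & forall c, \sum_(u | A c u) p u = b c].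
have objE e p p' : p =1 p' -> obj e p = obj e p'.
  move=> pp; rewrite (@objL e 0 p p' p') ?mul0r ?addr0 // => u.
  by rewrite mul0r addr0 pp.
have sz (M : array q nu) : M <> [::] -> (size M)%:R != 0 :> rat.
  by move/eqP; rewrite pnatr_eq0 size_eq0.
have okd M : ok M -> dist [ffun u => freq M u].
  move=> /okP[Mn MA]; split.
  - by move=> u; rewrite ffunE freq_ge0.
  - under eq_bigr do rewrite ffunE.
    by rewrite sum_freq count_predT divff ?sz.
  - move=> c; under eq_bigr do rewrite ffunE.
    have c0 : (N c)%:R != 0 :> rat by rewrite pnatr_eq0 -lt0n.
    rewrite sum_freq /b; apply: (mulIf (sz _ Mn)); rewrite divfK ?sz //.
    by rewrite -(MA c) natrM mulrCA mulVf ?mulr1.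
have [e [p [Qe dp pmax]]] := extremal_point objL Qe0 (okd _ okM0).
have [p0 p1 pA] := dp.
have [M Mn Mp] := realize_dist p0 p1.
have fM : freq M =1 p by exact: Mp.
exists M.
  apply/okP; split => // c.
  have c0 : (N c)%:R != 0 :> rat by rewrite pnatr_eq0 -lt0n.
  have := pA c; rewrite -(eq_bigr _ (fun u _ => fM u)) sum_freq /b => h.
  apply/eqP; rewrite -(eqr_nat rat) natrM.
  by rewrite -[(count _ _)%:R](divfK (sz _ Mn)) h mulrAC mulVf ?mul1r.
move=> M' okM'; rewrite topE; apply/bigmax_leP; split.
  by rewrite topE; apply: bigmax_ge_id.
move=> e' Qe'; rewrite topE; apply: le_trans (le_bigmax_cond _ _ Qe).
rewrite (objE e _ _ fM); have := pmax e' _ Qe' (okd _ okM').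
by rewrite (objE e' [ffun u => freq M' u] (freq M')) // => u; rewrite ffunE.
Qed.

Lemma full_orthogonal (q nu t : nat) : (1 < q)%N -> (t <= nu)%N ->
  orthogonal_array t (enum {: word q nu}).
Proof.
move=> q1 tnu.
have cq : #|'Z_q| = q by rewrite card_ord Zp_cast.
split=> //.
  move=> e0; have := mem_enum {: word q nu} (0 : word q nu).
  by rewrite e0.
move=> J v Jinc.
have Jinj : injective J.
  move=> i j Jij; apply/val_inj; case: (ltngtP i j) => // /Jinc;
  by rewrite Jij ltnn.
have cntE (w : word q t) :
    count (fun u : word q nu => restrict J u == w) (enum {: word q nu})
    = #|[pred u : word q nu | restrict J u == w]|.
  by rewrite cardE -size_filter enumT.
have eqc (w : word q t) : #|[pred u : word q nu | restrict J u == w]|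
    = #|[pred u : word q nu | restrict J u == v]|.
  have [z zJ] : exists z : word q nu, forall j, z (J j) = v j - w j.
    exists [ffun i => if [pick j | J j == i] is Some j then v j - w j else 0].
    move=> j; rewrite ffunE.
    by case: pickP => [j' /eqP/Jinj -> //|/(_ j)]; rewrite eqxx.
  rewrite -(card_image (addIr z)); apply: eq_card => u; rewrite !inE.
  apply/fintype.imageP/eqP => [[y]|uv].
    rewrite inE => /eqP yw ->; apply/ffunP => j.
    by rewrite !ffunE zJ -yw ffunE addrC subrK.
  exists (u - z); last by rewrite subrK.
  rewrite inE; apply/eqP/ffunP => j.
  by rewrite !ffunE zJ -uv ffunE subKr.
have szE : size (enum {: word q nu}) = \sum_(w : word q t)
    #|[pred u : word q nu | restrict J u == w]|.
  rewrite -cardE -sum1_card (partition_big (restrict J) xpredT) //=.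
  by apply: eq_bigr => w _; rewrite -sum1_card.
rewrite cntE szE (eq_bigr _ (fun w _ => eqc w)) sum_nat_const.
by rewrite card_ffun cq card_ord mulnC.
Qed.

Lemma orthogonal_difference (q nu t : nat) (M : array q nu) :
  (1 < q)%N -> (0 < t)%N -> orthogonal_array t M -> difference_scheme t M.
Proof.
move=> q1 t0 [Mn tnu MO]; split=> // J v Jinc _.
have cq : #|'Z_q| = q by rewrite card_ord Zp_cast.
have q0 : (0 < q ^ t)%N by rewrite expn_gt0 (ltnW q1).
have -> : count (fun u : word q nu => shift_class v (restrict J u)) M =
   (\sum_(a : 'Z_q) count (fun u : word q nu => restrict J u == (v + cst_word t a)%R) M)%N.
  elim: M {Mn MO} => [|u M IH] /=; first by rewrite big1.
  rewrite big_split /= -IH; congr (_ + _)%N.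
  rewrite /shift_class; case: existsP => [[a /eqP ua]|nex].
    rewrite (bigD1 a) //= ua eqxx big1 // => b ba; apply/eqP.
    rewrite eqb0; apply: contraNN ba => /eqP/addrI/ffunP/(_ (Ordinal t0)).
    by rewrite !ffunE => ->.
  rewrite big1 // => a _; apply/eqP; rewrite eqb0; apply/negP => h.
  by apply: nex; exists a.
rewrite big_distrl /=.
have cE a : (count (fun u : word q nu => restrict J u == (v + cst_word t a)%R) M *
    q ^ (t - 1) * q = size M)%N.
  by rewrite -mulnA -expnSr subn1 prednK // MO.
apply/eqP; rewrite -(eqn_pmul2r (ltnW q1)) big_distrl /=.
by rewrite (eq_bigr _ (fun a _ => cE a)) sum_nat_const cq mulnC.
Qed.

Lemma sup_largest (R : realType) (T : Type) (ok : T -> Prop) (f : T -> rat) :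
  (exists2 M, ok M & forall M', ok M' -> f M' <= f M) ->
  let s := sup [set r : R | exists2 M, ok M & r = ratr (f M)]%classic in
  (exists2 M, ok M & ratr (f M) = s) /\ (forall M, ok M -> ratr (f M) <= s).
Proof.
move=> [M okM Mmax] s.
have Mub : ubound [set r : R | exists2 M, ok M & r = ratr (f M)]%classic
    (ratr (f M)).
  by move=> _ [M' okM' ->]; rewrite ler_rat; exact: Mmax.
have sE : s = ratr (f M).
  apply/eqP; rewrite eq_le; apply/andP; split.
    by apply: ge_sup => //; exists (ratr (f M)), M.
  by apply: ub_le_sup; [exists (ratr (f M)) | exists M].
by split; [exists M | move=> M' okM'; rewrite sE ler_rat; exact: Mmax].
Qed.

Theorem rho_largest (R : realType) (nu q t : nat) :
    (1 < q)%N -> (t <= nu)%N ->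
  (exists2 M : array q nu,
     orthogonal_array t M & ratr (max_freq M) = rho R nu q t) /\
  (forall M : array q nu, orthogonal_array t M ->
     ratr (max_freq M) <= rho R nu q t).
Proof.
move=> q1 tnu; apply: sup_largest.
pose C := ({J : 'I_t -> 'I_nu | increasing J} * word q t)%type.
apply: (@array_extremal q nu C
  (fun c u => restrict (projT1 c.1) u == c.2) (fun=> (q ^ t)%N)
  (word q nu) xpredT (fun u p => p u)).
- by move=> _; rewrite expn_gt0 (ltnW q1).
- by move=> e s p d r ->.
- move=> M; split=> [[Mn _ MO]|[Mn MO]].
    by split=> // -[[J Jinc] v]; exact: MO.
  by split=> // J v Jinc; exact: (MO (exist _ J Jinc, v)).
- by [].
- by exists 0.
- by exists (enum {: word q nu}); exact: full_orthogonal.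
Qed.

Theorem rho_E_largest (R : realType) (nu q t : nat) :
    (1 < q)%N -> (0 < t <= nu)%N ->
  (exists2 M : array q nu,
     difference_scheme t M & ratr (max_class_freq M) = rho_E R nu q t) /\
  (forall M : array q nu, difference_scheme t M ->
     ratr (max_class_freq M) <= rho_E R nu q t).
Proof.
move=> q1 /andP[t0 tnu]; apply: sup_largest.
pose C := ({J : 'I_t -> 'I_nu | increasing J} *
           {v : word q t | starts_with0 v})%type.
apply: (@array_extremal q nu C
  (fun c u => shift_class (val c.2) (restrict (projT1 c.1) u))
  (fun=> (q ^ (t - 1))%N) (word q nu) (@starts_with0 q nu)
  (fun v p => \sum_(a : 'Z_q) p (v + cst_word nu a))).
- by move=> _; rewrite expn_gt0 (ltnW q1).
- move=> e s p d r rE; rewrite mulr_sumr -big_split.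
  by apply: eq_bigr => a _; exact: rE.
- move=> M; split=> [[Mn _ MO]|[Mn MO]].
    by split=> // -[[J Jinc] [v v0]]; exact: MO.
  by split=> // J v Jinc v0; exact: (MO (exist _ J Jinc, exist _ v v0)).
- by [].
- by exists 0; apply/forallP => j; rewrite ffunE eqxx implybT.
- exists (enum {: word q nu}); apply: orthogonal_difference => //.
  exact: full_orthogonal.
Qed.

(* Main.v *)
Require Import Defs.
From mathcomp Require Import all_boot all_order all_algebra.
From mathcomp Require Import reals.

(** Why the bounds hold.  Colour the variables with the nu classes of an optimal
    strong colouring, let xo be an optimal solution, and let w be the most
    frequent row of an array M whose columns are the colours.  A row u shifts a
    solution by adding the entry u_c to every variable of colour c.  Consider
    the solutions xo - w + u, with u a random row of M.

    Each constraint sees distinct colours on its scope, at most k of them, so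
    strength k makes the shift uniform on the scope.  Hence the expected value of
    the random solution is the mean value of the instance (sum_value_paint).
    With probability at least the frequency of w the row is w and the solution
    is xo itself; otherwise its value is at worst wor I.  Comparing both
    estimates gives exactly that frequency as a lower bound on the average
    differential ratio (ratio_ge_mass).

    If every constraint is t-wise independent, t colour classes can be left
    unshifted: a constraint then has at most t frozen coordinates while the others
    are uniform, and t-wise independence says that the frozen coordinates do not
    affect the average (sum_paint).  This leaves nu - t columns and asks only for
    strength min(k, nu - t).  The bound for arbitrary constraints is the case t = 0,
    in which every function qualifies, so both follow from ratio_ge_rho.

    If every constraint is invariant under adding a constant word, adding a
    uniform constant to a random row of a difference scheme leaves the value of
    the solution unchanged, and turns the rows into the distribution of an
    orthogonal array (balanced_difference).  All rows in the most frequent shift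
    class then yield optimal solutions (ratio_ge_rho_E).

    Uniformity of marginals is carried throughout by balanced_on, which applies
    both to row distributions and to the constraint functions. *)

Set Implicit Arguments.
Unset Strict Implicit.
Unset Printing Implicit Defensive.

Import Order.TTheory GRing.Theory Num.Theory.

Local Open Scope ring_scope.

(** * Increasing column selections *)

Lemma increasing_inj (m n : nat) (J : 'I_m -> 'I_n) : increasing J -> injective J.
Proof.
move=> Jinc i j Jij; apply/val_inj; case: (ltngtP i j) => // /Jinc;
by rewrite Jij ltnn.
Qed.

(** Marginals in the definitions are indexed by increasing maps, marginals below by
    sets of columns; every set of columns comes from an increasing map. *)
Lemma increasing_enum_val (n : nat) (A : {set 'I_n}) :
  increasing (fun i : 'I_#|A| => enum_val i).
Proof.
move=> i j ij; have n_gt0 : (0 < n)%N by apply: leq_ltn_trans (ltn_ord (enum_val i)).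
pose x0 := Ordinal n_gt0; rewrite !(enum_val_nth x0).
have valE (l : 'I_#|A|) :
    nth x0 (enum A) l = nth 0%N [seq val x | x <- enum A] l :> nat.
  by rewrite (nth_map x0) // -cardE.
rewrite !valE; apply: (sorted_ltn_nth ltn_trans) => //.
- have -> : [seq val x | x <- enum A] =
      [seq i <- iota 0 n | i \in [seq val x | x <- enum A]].
    rewrite -val_enum_ord filter_map; congr map.
    rewrite {1}/enum_mem -enumT; apply: eq_filter => x /=.
    by rewrite mem_map ?mem_enum //; exact: val_inj.
  exact: (sorted_filter ltn_trans _ (iota_ltn_sorted 0 n)).
- by rewrite inE size_map -cardE.
- by rewrite inE size_map -cardE.
Qed.

(** * Functions with uniform marginals *)

Section Balanced.
Variables (R : numFieldType) (q m : nat).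
Hypothesis q_gt1 : (1 < q)%N.
Implicit Types (f : word q m -> R) (A B : {set 'I_m}) (u w : word q m).

Definition agree A u w : bool := [forall j in A, u j == w j].

Lemma agreeP A u w : reflect {in A, u =1 w} (agree A u w).
Proof. exact: eqfun_inP. Qed.

(** The marginal of f on the columns A is uniform.  Multiplying by q ^ #|A| avoids
    division, and f need not be nonnegative, so that constraint functions fit
    as well as distributions. *)
Definition balanced_on f A : Prop :=
  forall w, (\sum_(u | agree A u w) f u) * (q ^ #|A|)%:R = \sum_u f u.

Lemma card_Zq : #|'Z_q| = q.
Proof. by rewrite card_ord Zp_cast. Qed.

Lemma powq_neq0 (n : nat) : (q ^ n)%:R != 0 :> R.
Proof. by rewrite pnatr_eq0 -lt0n expn_gt0 (ltnW q_gt1). Qed.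

Lemma balanced_on0 f : balanced_on f set0.
Proof.
move=> w; rewrite cards0 expn0 mulr1; apply: eq_bigl => u.
by apply/agreeP => j; rewrite inE.
Qed.

Lemma balanced_on_const (c : R) : balanced_on (fun=> c) [set: 'I_m].
Proof.
move=> w; rewrite (big_pred1 w); last first.
  move=> u /=; apply/agreeP/eqP => [uw | -> //].
  by apply/ffunP => j; apply: uw; rewrite inE.
by rewrite sumr_const cardsT card_ord card_ffun card_Zq card_ord mulr_natr.
Qed.

(** Marginals can be coarsened: summing over the q values of column j turns the
    marginal on j |: A into the one on A. *)
Lemma balanced_on_setU1 f A j : j \notin A ->
  balanced_on f (j |: A) -> balanced_on f A.
Proof.
move=> jA bal w.
apply: (mulIf (powq_neq0 1)); rewrite expn1 -mulrA -natrM -expnSr.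
rewrite (partition_big (fun u => u j) xpredT) //= mulr_suml.
rewrite mulr_natr -[X in _ = _ *+ X]card_Zq -sumr_const; apply: eq_bigr => a _.
rewrite -(bal [ffun i => if i == j then a else w i]) cardsU1 jA add1n.
congr (_ * _); apply: eq_bigl => u.
apply/andP/agreeP => [[/agreeP uw /eqP uj] i | uw].
  rewrite in_setU1 ffunE; case: eqP => [-> //|_ /=]; exact: uw.
split; last by have := uw j; rewrite ffunE eqxx setU11 => ->.
apply/agreeP => i iA; have := uw i; rewrite ffunE in_setU1 iA orbT => -> //.
by case: eqP iA jA => // -> ->.
Qed.

(** A set of fewer than t columns extends to one of size t, because t <= m;
    this is why strength t controls scopes of any smaller size. *)
Lemma balanced_on_small f t B : (t <= m)%N -> (#|B| <= t)%N ->
  (forall A, #|A| = t -> balanced_on f A) -> balanced_on f B.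
Proof.
move=> tm Bt bal; have [n] := ubnP (t - #|B|).
elim: n B Bt => // n IH B Bt ltn.
have [/bal //|Bneq] := eqVneq #|B| t.
have Blt : (#|B| < t)%N by rewrite ltn_neqAle Bneq.
have [j jB] : exists j, j \notin B.
  apply/existsP; rewrite -negb_forall; apply/negP => /forallP allB.
  have : (m <= #|B|)%N.
    by rewrite -[X in (X <= _)%N]card_ord; apply/subset_leq_card/subsetP => j _;
    exact: allB.
  by rewrite leqNgt (leq_trans Blt tm).
have cB : #|j |: B| = #|B|.+1 by rewrite cardsU1 jB.
apply: (balanced_on_setU1 jB); apply: IH; first by rewrite cB.
rewrite cB; apply: leq_trans (_ : t - #|B| <= n)%N => //.
by apply: ltn_sub2l.
Qed.

Lemma balanced_on_increasing f t B : (t <= m)%N -> (#|B| <= t)%N ->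
  (forall (J : 'I_t -> 'I_m) (v : word q t), increasing J ->
     (\sum_(u | restrict J u == v) f u) * (q ^ t)%:R = \sum_u f u) ->
  balanced_on f B.
Proof.
move=> tm Bt marg; apply: (balanced_on_small tm Bt) => A cA w.
move: marg; rewrite -{t tm Bt}cA => marg.
have <- := marg _ (restrict (fun i : 'I_#|A| => enum_val i) w) (@increasing_enum_val _ A).
congr (_ * _); apply: eq_bigl => u; apply/agreeP/eqP => [uw | uw j jA].
  by apply/ffunP => i; rewrite !ffunE uw // enum_valP.
move/ffunP/(_ (enum_rank_in jA j)): uw.
by rewrite !ffunE enum_rankK_in.
Qed.

End Balanced.

(** * Shifting a word through a colouring *)

(** Coordinates of colour None are the frozen ones: they are shifted by 0. *)
Definition paint (q m h : nat) (e : 'I_h -> option 'I_m) (u : word q m) : word q h :=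
  [ffun j => oapp u 0 (e j)].

Definition blank (m h : nat) (e : 'I_h -> option 'I_m) : {set 'I_h} :=
  [set j | e j == None].

(** No colour is repeated, except that any number of coordinates may be frozen. *)
Definition rainbow (m h : nat) (e : 'I_h -> option 'I_m) : Prop :=
  forall j j', e j = e j' -> e j != None -> j = j'.

Definition colors_used (m h : nat) (e : 'I_h -> option 'I_m) : {set 'I_m} :=
  [set i | [exists j, e j == Some i]].

Section Shift.
Variables (R : numFieldType) (q : nat).
Hypothesis q_gt1 : (1 < q)%N.

Lemma card_colors_used (m h : nat) (e : 'I_h -> option 'I_m) :
  rainbow e -> (#|colors_used e| + #|blank e| = h)%N.
Proof.
move=> re; rewrite addnC -[RHS]card_ord -(cardsC (blank e)); congr addn.
rewrite -(card_imset _ Some_inj) -(@card_in_imset _ _ e) => [|j j']; last first.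
  by rewrite !inE => ej _ /re ->.
apply: eq_card => o; apply/imsetP/imsetP => [[i]|[j]].
  by rewrite inE => /existsP[j /eqP ej] ->; exists j; rewrite ?inE ej.
rewrite !inE; case ej: (e j) => [i|] // _ ->; exists i => //.
by rewrite inE; apply/existsP; exists j; rewrite ej.
Qed.

Lemma colors_used_le (m h : nat) (e : 'I_h -> option 'I_m) :
  rainbow e -> (#|colors_used e| <= h)%N.
Proof. by move/card_colors_used => {2}<-; exact: leq_addr. Qed.

(** The expected value of P at a randomly shifted word is its mean.  The shifted
    word z always agrees with y on the frozen coordinates, and each such z arises
    from the same share q ^- #|colors_used e| of the mass of f, since it prescribes
    u exactly on the colours in use.  What remains is the marginal of P on the frozen
    coordinates, uniform as well. *)
Lemma sum_paint (m h : nat) (e : 'I_h -> option 'I_m) (f : word q m -> R)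
    (P : word q h -> R) (y : word q h) :
  rainbow e -> balanced_on f (colors_used e) -> balanced_on P (blank e) ->
  (\sum_u f u * P (y + paint e u)) * (q ^ h)%:R = (\sum_u f u) * \sum_z P z.
Proof.
move=> re balf balP.
(* Group the words u by the shifted word z; [pick j | e j == Some i] recovers the
   only coordinate of colour i, so z - y there is the value forced upon u i. *)
have -> : \sum_u f u * P (y + paint e u) =
    \sum_(z | agree (blank e) z y)
       P z * \sum_(u | agree (colors_used e) u
                [ffun i => oapp (z - y) 0 [pick j | e j == Some i]]) f u.
  rewrite (partition_big (fun u => y + paint e u) (fun z => agree (blank e) z y)) /=.
    apply: eq_bigr => z /agreeP zy; rewrite mulr_sumr.
    rewrite [LHS](eq_bigr (fun u => P z * f u)) => [|u /eqP ->]; last by rewrite mulrC.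
    apply: eq_bigl => u; apply/eqP/agreeP => [<- i|uz].
      rewrite inE => /existsP[j /eqP ej]; rewrite ffunE.
      case: pickP => [j' /eqP ej' | /(_ j)]; last by rewrite ej eqxx.
      by rewrite /= !ffunE ej' /= addrAC subrr add0r.
    apply/ffunP => j; rewrite !ffunE; case ej: (e j) => [i|] /=; last first.
      by rewrite addr0 zy // inE ej.
    rewrite uz; last by rewrite inE; apply/existsP; exists j; rewrite ej.
    rewrite ffunE; case: pickP => [j' /eqP ej' | /(_ j)]; last by rewrite ej eqxx.
    have <- : j = j' by apply: re; rewrite ej ?ej'.
    by rewrite /= !ffunE addrC subrK.
  move=> u _; apply/agreeP => j; rewrite inE => /eqP ej.
  by rewrite !ffunE ej /= addr0.
rewrite -[X in (q ^ X)%:R](card_colors_used re) expnD natrM mulrA mulr_suml.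
under eq_bigr do rewrite -mulrA balf.
by rewrite -mulr_suml mulrAC balP mulrC.
Qed.

End Shift.

(** * Random solutions of an instance *)

Section Instances.
Variables (R : realType) (q k : nat) (I : instance R q k).
Hypothesis q_gt1 : (1 < q)%N.

(** A uniform solution is uniform on each scope: the case of sum_paint where every
    variable has its own colour and the word of shifts is uniform. *)
Lemma mean_valueE :
  mean_value I = \sum_(i < Defs.ncons I) weight i * mean_fun (constraint I i).
Proof.
rewrite /mean_value /value exchange_big /= mulr_suml; apply: eq_bigr => i _.
rewrite -mulr_sumr -mulrA; congr (_ * _).
apply: (mulIf (powq_neq0 R q_gt1 (nvars I))); rewrite divfK ?powq_neq0 //.
apply: (mulIf (powq_neq0 R q_gt1 (arity i))).
rewrite mulrAC /mean_fun divfK ?powq_neq0 //.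
pose e j := Some (scope I i j).
have re : rainbow e.
  by move=> j j' [/(increasing_inj (@scope_increasing _ _ _ I i))].
have blank0 : blank e = set0 by apply/setP => j; rewrite !inE.
have bal1 : balanced_on (fun _ : word q (nvars I) => 1 : R) (colors_used e).
  apply: (balanced_on_small q_gt1 (leqnn _) _) => [|A cA].
    by rewrite -[X in (_ <= X)%N]card_ord max_card.
  rewrite (_ : A = setT); first exact: balanced_on_const.
  by apply/eqP; rewrite eqEcard subsetT cardsT card_ord cA leqnn.
have := sum_paint (0 : word q (arity i)) re bal1.
rewrite blank0 => /(_ (constraint I i) (balanced_on0 _)).
rewrite sumr_const card_ffun card_Zq // card_ord [RHS]mulrC => <-.
by congr (_ * _); apply: eq_bigr => u _; rewrite mul1r add0r.
Qed.

Lemma sum_value_paint (m : nat) (d : 'I_(nvars I) -> option 'I_m)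
    (f : word q m -> R) (x : word q (nvars I)) :
  \sum_u f u = 1 ->
  (forall i, [/\ rainbow (d \o scope I i), balanced_on f (colors_used (d \o scope I i))
     & balanced_on (constraint I i) (blank (d \o scope I i))]) ->
  \sum_u f u * value (x + paint d u) = mean_value I.
Proof.
move=> f1 bal; rewrite mean_valueE.
under eq_bigr do rewrite mulr_sumr.
rewrite exchange_big /=; apply: eq_bigr => i _; have [re balf balP] := bal i.
have := sum_paint (restrict (scope I i) x) re balf balP.
rewrite f1 mul1r => sP.
rewrite /mean_fun -sP mulfK ?powq_neq0 // mulr_sumr; apply: eq_bigr => u _.
rewrite mulrCA; congr (_ * (_ * constraint I i _)).
by apply/ffunP => j; rewrite !ffunE.
Qed.

Lemma max_value_ge (x : word q (nvars I)) : value x <= max_value I.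
Proof. by rewrite /max_value; case: arg_maxP => // y _; exact. Qed.

Lemma min_value_le (x : word q (nvars I)) : min_value I <= value x.
Proof. by rewrite /min_value; case: arg_minP => // y _; exact. Qed.

Lemma opt_attained : exists x : word q (nvars I), value x = opt I.
Proof. by rewrite /opt; case: (objective I); eexists. Qed.

(** Writing solution values as differential ratios treats both goals alike: for
    minimization the numerator and the denominator are both nonpositive. *)
Lemma differential_ratio_ge0 (x : word q (nvars I)) :
  0 <= (value x - wor I) / (opt I - wor I).
Proof.
have le := le_trans (min_value_le x) (max_value_ge x).
rewrite /opt /wor; case: (objective I).
  by rewrite divr_ge0 // subr_ge0 // min_value_le.
by rewrite -mulrNN -invrN !opprB divr_ge0 // subr_ge0 // max_value_ge.
Qed.

(** The mean of the differential ratios of the random solution x u is the average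
    differential ratio; its terms are nonnegative and equal to 1 on S. *)
Lemma ratio_ge_mass (W : finType) (f : W -> R) (x : W -> word q (nvars I)) (S : pred W) :
  opt I <> wor I -> (forall u, 0 <= f u) -> \sum_u f u = 1 ->
  \sum_u f u * value (x u) = mean_value I ->
  (forall u, S u -> value (x u) = opt I) ->
  \sum_(u | S u) f u <= avg_differential_ratio I.
Proof.
move=> /eqP neq f0 f1 fv xS.
have -> : avg_differential_ratio I =
    \sum_u f u * ((value (x u) - wor I) / (opt I - wor I)).
  rewrite /avg_differential_ratio -fv -[X in _ - X]mul1r -f1 mulr_suml -sumrB.
  by rewrite mulr_suml; apply: eq_bigr => u _; rewrite -mulrBr mulrA.
rewrite [leRHS](bigID S) /= -[leLHS]addr0; apply: lerD.
  by apply: ler_sum => u Su; rewrite xS // divff ?mulr1 // subr_eq0.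
by apply: sumr_ge0 => u _; rewrite mulr_ge0 ?differential_ratio_ge0.
Qed.

(** The first m classes of a strong colouring serve as colours and the variables
    in the remaining ones, at most t classes, are frozen.  A scope meets each
    class at most once, so it has at most t frozen variables. *)
Lemma coloring_of_strong_chromatic_number (nu m t : nat) :
  is_strong_chromatic_number I nu -> (nu <= m + t)%N ->
  exists d : 'I_(nvars I) -> option 'I_m,
    forall i, rainbow (d \o scope I i) /\ (#|blank (d \o scope I i)| <= t)%N.
Proof.
move=> [[P [[partP colP] cP]] _] nu_le.
pose g x := index (pblock P x) (enum P).
have [/eqP covP _ _] := and3P partP.
have inP x : pblock P x \in P by apply: pblock_mem; rewrite covP inE.
have xin x : x \in pblock P x by rewrite mem_pblock covP inE.
have g_lt x : (g x < m + t)%N.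
  by apply: leq_trans nu_le; rewrite -cP cardE index_mem mem_enum.
have g_inj i : injective (g \o scope I i).
  move=> j j' /= /(congr1 (nth set0 (enum P))).
  rewrite !nth_index ?mem_enum // => eqb.
  apply: (increasing_inj (@scope_increasing _ _ _ I i)).
  have /card_le1_eqP := colP i _ (inP (scope I i j)); apply.
    by rewrite in_setI eqb xin imset_f.
  by rewrite in_setI xin imset_f.
exists (fun x => insub (g x)) => i; split=> [j j' /=|].
  case: insubP => [u _ uE|] //; case: insubP => [u' _ u'E|] // [uu'] _.
  by apply: (g_inj i); rewrite /= -uE -u'E uu'.
rewrite cardE -(size_map (g \o scope I i)) -[X in (_ <= X)%N](size_iota m t).
apply: uniq_leq_size; first by rewrite (map_inj_uniq (@g_inj i)) enum_uniq.
move=> l /mapP[j]; rewrite mem_enum inE /= => jb ->.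
rewrite mem_iota g_lt andbT; case: insubP jb => // ; by rewrite -leqNgt.
Qed.

End Instances.

(** * Row distributions of arrays *)

Section Arrays.
Variables (R : realType) (q : nat).
Hypothesis q_gt1 : (1 < q)%N.

Definition row_mass (m : nat) (M : array q m) (u : word q m) : R := ratr (freq M u).

Lemma row_mass_ge0 (m : nat) (M : array q m) u : 0 <= row_mass M u.
Proof. by rewrite /row_mass ler0q freq_ge0. Qed.

Lemma sum_row_mass (m : nat) (M : array q m) (a : pred (word q m)) :
  \sum_(u | a u) row_mass M u = (count a M)%:R / (size M)%:R.
Proof. by rewrite -rmorph_sum sum_freq fmorph_div /= !ratr_nat. Qed.

Lemma size_neq0 (m : nat) (M : array q m) : M <> [::] -> (size M)%:R != 0 :> R.
Proof. by move/eqP; rewrite pnatr_eq0 size_eq0. Qed.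

Lemma row_mass_total (m : nat) (M : array q m) :
  M <> [::] -> \sum_u row_mass M u = 1.
Proof. by move=> M0; rewrite sum_row_mass count_predT divff ?size_neq0. Qed.

Lemma balanced_orthogonal (m t : nat) (M : array q m) (B : {set 'I_m}) :
  orthogonal_array t M -> (#|B| <= t)%N -> balanced_on (row_mass M) B.
Proof.
move=> [M0 tm MO] Bt; apply: (balanced_on_increasing q_gt1 tm Bt) => J v Jinc.
rewrite row_mass_total // sum_row_mass mulrAC -natrM MO // divff //.
exact: size_neq0.
Qed.

Lemma balanced_family_I (t h : nat) (P : word q h -> R) (B : {set 'I_h}) :
  family_I t P -> (#|B| <= t)%N -> balanced_on P B.
Proof.
move=> [th PI] Bt; apply: (balanced_on_increasing q_gt1 th Bt) => J v Jinc.
have := PI J v Jinc.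
move/(congr1 ( *%R^~ (q ^ h)%:R)); rewrite /mean_fun divfK ?powq_neq0 // => <-.
rewrite -[X in _ / _ * (q ^ X)%:R](subnKC th) expnD natrM [RHS]mulrCA.
by rewrite divfK ?powq_neq0 // mulrC.
Qed.

(** The translates v + a are pairwise distinct, as their first entries differ. *)
Lemma sum_shift_class (T : finType) (h : nat) (v : word q h) (g : T -> word q h)
    (F : T -> R) : (0 < h)%N ->
  \sum_(x | shift_class v (g x)) F x =
  \sum_(a : 'Z_q) \sum_(x | g x == v + cst_word h a) F x.
Proof.
move=> h_gt0; pose j0 := Ordinal h_gt0.
rewrite (partition_big (fun x => g x j0 - v j0) xpredT) //=.
apply: eq_bigr => a _; apply: eq_bigl => x.
apply/andP/eqP => [[/existsP[b /eqP ->]]|gE].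
  by rewrite !ffunE addrAC subrr add0r => /eqP ->.
split; first by apply/existsP; exists a; rewrite gE.
by rewrite gE !ffunE addrAC subrr add0r.
Qed.

Lemma cst_wordD (h : nat) (a b : 'Z_q) :
  cst_word h (a + b) = cst_word h a + cst_word h b.
Proof. by apply/ffunP => j; rewrite !ffunE. Qed.

Lemma cst_wordN (h : nat) (a : 'Z_q) : cst_word h (- a) = - cst_word h a.
Proof. by apply/ffunP => j; rewrite !ffunE. Qed.

(** The law of a random row of M plus an independent uniform constant word. *)
Definition shift_average (m : nat) (M : array q m) (u : word q m) : R :=
  (\sum_(a : 'Z_q) row_mass M (u - cst_word m a)) / q%:R.

Lemma shift_average_ge0 (m : nat) (M : array q m) u : 0 <= shift_average M u.
Proof. by rewrite divr_ge0 ?ler0n // sumr_ge0 // => a _; exact: row_mass_ge0. Qed.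

Lemma sum_shift_average (m : nat) (M : array q m) (A : pred (word q m)) :
  \sum_(u | A u) shift_average M u =
  (\sum_(a : 'Z_q) \sum_(u : word q m | A (u + cst_word m a)) row_mass M u) / q%:R.
Proof.
rewrite -mulr_suml exchange_big /=; congr (_ / _); apply: eq_bigr => a _.
rewrite (reindex_inj (@addIr (word q m) (cst_word m a))) /=.
by apply: eq_bigr => u _; rewrite addrK.
Qed.

Lemma q_neq0 : q%:R != 0 :> R.
Proof. by rewrite pnatr_eq0 -lt0n (ltnW q_gt1). Qed.

Lemma sum_shift_average_invariant (m : nat) (M : array q m) (A : pred (word q m)) :
  (forall (u : word q m) (a : 'Z_q), A (u + cst_word m a) = A u) ->
  \sum_(u | A u) shift_average M u = \sum_(u | A u) row_mass M u.
Proof.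
move=> Ainv; rewrite sum_shift_average (eq_bigr (fun=> \sum_(u | A u) row_mass M u)).
  by rewrite sumr_const card_Zq // -[X in X / _]mulr_natr mulfK ?q_neq0.
by move=> a _; apply: eq_bigl => u.
Qed.

Lemma shift_class_invariant (h : nat) (v u : word q h) (a : 'Z_q) :
  shift_class v (u + cst_word h a) = shift_class v u.
Proof.
apply/existsP/existsP => -[b /eqP ub].
  exists (b - a); apply/eqP.
  by rewrite cst_wordD cst_wordN addrA -ub addrK.
by exists (b + a); rewrite ub cst_wordD addrA.
Qed.

(** Under the averaged law, hitting v on the columns J has probability 1/q times
    that of a row of M meeting the shift class of v there, and the strength of
    M prescribes the latter. *)
Lemma balanced_difference (m t : nat) (M : array q m) (B : {set 'I_m}) :
  (0 < t)%N -> difference_scheme t M -> (#|B| <= t)%N -> balanced_on (shift_average M) B.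
Proof.
move=> t_gt0 [M0 tm MD] Bt; apply: (balanced_on_increasing q_gt1 tm Bt) => J v Jinc.
rewrite (@sum_shift_average_invariant _ _ predT) // row_mass_total // sum_shift_average.
(* The representative of the shift class of v that starts with 0. *)
pose v0 := v + cst_word t (- v (Ordinal t_gt0)).
have v0_0 : starts_with0 v0.
  apply/forallP => j; apply/implyP => /eqP j0; rewrite !ffunE.
  by rewrite (_ : Ordinal t_gt0 = j) ?subrr //; apply/val_inj.
have -> : \sum_a \sum_(u : word q m | restrict J (u + cst_word m a) == v) row_mass M u =
    \sum_(u | shift_class v0 (restrict J u)) row_mass M u.
  rewrite (eq_bigl (fun u => shift_class v (restrict J u))) => [|u]; last first.
    rewrite /v0; apply/existsP/existsP => -[a /eqP ->].
      by eexists; rewrite -addrA -cst_wordD.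
    exists (v (Ordinal t_gt0) + a); rewrite -addrA -cst_wordD.
    by rewrite addrA addNr add0r.
  rewrite sum_shift_class // (reindex_inj (@oppr_inj 'Z_q)); apply: eq_bigr => a _.
  apply: eq_bigl => u; rewrite cst_wordN -subr_eq0 -[RHS]subr_eq0.
  congr (_ == 0); apply/ffunP => j; by rewrite !ffunE opprD addrA addrAC.
have -> : (q ^ t)%:R = (q ^ (t - 1))%:R * q%:R :> R.
  by rewrite -natrM -expnSr subn1 prednK.
rewrite mulrCA divfK ?q_neq0 // sum_row_mass mulrA [X in X / _]mulrC.
by rewrite -natrM MD // divff // size_neq0.
Qed.

Lemma ratr_bigmax_le (T : finType) (Q : pred T) (F : T -> rat) (r : R) : 0 <= r ->
  (forall x, Q x -> ratr (F x) <= r) ->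
  ratr (\big[Num.max/0]_(x | Q x) F x) <= r.
Proof.
move=> r0 Fr; apply: (big_ind (fun s => ratr s <= r)) => //; first by rewrite rmorph0.
by move=> s1 s2 h1 h2; rewrite maxEle; case: ifP.
Qed.

End Arrays.

(** * Lower bounds on the average differential ratio *)

Section Bounds.
Variables (R : realType) (q k : nat) (I : instance R q k).
Hypothesis q_gt1 : (1 < q)%N.
Hypothesis nontrivial : opt I <> wor I.

Lemma arity_le_k i : (arity (i0 := I) i <= k)%N.
Proof. exact: leq_trans (@arity_le _ _ _ I i) (geq_minl _ _). Qed.

(** The hypothesis on the constraints covers t-wise independent families, and holds
    for all functions when t = 0. *)
Lemma ratio_ge_rho (nu m t : nat) :
  is_strong_chromatic_number I nu -> (nu <= m + t)%N ->
  (forall i (B : {set 'I_(arity i)}), (#|B| <= t)%N -> balanced_on (constraint I i) B) ->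
  rho R m q (minn k m) <= avg_differential_ratio I.
Proof.
move=> chi nu_le balP.
have [d dP] := coloring_of_strong_chromatic_number chi nu_le.
have [[M MO <-] _] := rho_largest R q_gt1 (geq_minr k m).
have [M0 _ _] := MO.
have [xo xoE] := opt_attained I.
have mass_le (w : word q m) (S : pred (word q m)) :
    (forall u, S u -> u = w) -> \sum_(u | S u) row_mass R M u <= avg_differential_ratio I.
  move=> Sw.
  apply: (ratio_ge_mass (x := fun u => xo - paint d w + paint d u)) => //.
  - exact: row_mass_ge0.
  - exact: row_mass_total.
  - apply: sum_value_paint => // [|i]; first exact: row_mass_total.
    have [re bl] := dP i; split=> //; last exact: balP.
    apply: (balanced_orthogonal R q_gt1 MO); rewrite leq_min; apply/andP; split.
      exact: leq_trans (colors_used_le re) (arity_le_k i).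
    by rewrite -[X in (_ <= X)%N]card_ord max_card.
  - by move=> u /Sw ->; rewrite subrK.
(* The default 0 of the maximum is covered by an empty set of rows. *)
apply: ratr_bigmax_le => [|w _].
  by have := mass_le 0 pred0; rewrite big_pred0_eq; exact.
by have := mass_le w (pred1 w); rewrite big_pred1_eq; apply => u /eqP.
Qed.

(** The law of the shifts is the averaged one, so that the mean value is
    reproduced; the set of favourable shifts is a whole shift class, on which
    averaging does not change the mass. *)
Lemma ratio_ge_rho_E (nu : nat) : (0 < k)%N ->
  csp_over (@family_E R q) I ->
  is_strong_chromatic_number I nu -> (k <= nu)%N ->
  rho_E R nu q k <= avg_differential_ratio I.
Proof.
move=> k_gt0 IE chi k_le.
have [d dP] : exists d : 'I_(nvars I) -> option 'I_nu,
    forall i, rainbow (d \o scope I i) /\ (#|blank (d \o scope I i)| <= 0)%N.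
  by apply: coloring_of_strong_chromatic_number chi _; rewrite addn0.
have [|[M MD <-] _] := @rho_E_largest R nu q k q_gt1; first by rewrite k_gt0.
have [M0 _ _] := MD.
have [xo xoE] := opt_attained I.
have shift_average_total : \sum_u shift_average R M u = 1.
  by rewrite (@sum_shift_average_invariant R q q_gt1 _ _ predT) // row_mass_total.
have value_cst (x : word q (nvars I)) (u : word q nu) a :
    value (x + paint d (u + cst_word nu a)) = value (x + paint d u).
  apply: eq_bigr => i _; congr (_ * _).
  rewrite -(IE i (restrict (scope I i) (x + paint d u)) a); congr (constraint I i _).
  apply/ffunP => j; rewrite !ffunE; have [_] := dP i.
  rewrite leqn0 => /eqP/cards0_eq/setP/(_ j); rewrite !inE /=.
  by case: (d _) => [c|] //= _; rewrite !ffunE addrA.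
have mass_le (w : word q nu) (S : pred (word q nu)) :
    (forall u, S u -> shift_class w u) ->
    \sum_(u | S u) shift_average R M u <= avg_differential_ratio I.
  move=> Sw.
  apply: (ratio_ge_mass (x := fun u => xo - paint d w + paint d u)) => //.
  - exact: shift_average_ge0.
  - apply: sum_value_paint => // i.
    have [re bl] := dP i; split=> //.
      apply: (balanced_difference R q_gt1 k_gt0 MD).
      exact: leq_trans (colors_used_le re) (arity_le_k i).
    rewrite (_ : blank _ = set0); first exact: balanced_on0.
    by apply: cards0_eq; apply/eqP; rewrite -leqn0.
  - by move=> u /Sw/existsP[a /eqP ->]; rewrite value_cst subrK.
(* The default 0 of the maximum is covered by an empty set of rows. *)
apply: ratr_bigmax_le => [|w _].
  by have := mass_le 0 pred0; rewrite big_pred0_eq; exact.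
have := mass_le w (shift_class w) (fun _ => id).
rewrite sum_shift_average_invariant // => [|u a]; last exact: shift_class_invariant.
rewrite sum_shift_class ?(leq_trans k_gt0) // rmorph_sum; congr (_ <= _).
by apply: eq_bigr => a _; rewrite big_pred1_eq.
Qed.

End Bounds.

Theorem theorem2p1 (R : realType) (q k t : nat)
    (hq : (2 <= q)%N) (hk : (2 <= k)%N) (ht : (1 <= t <= k - 1)%N) :
  [/\ forall (I : instance R q k) (nu : nat),
        is_strong_chromatic_number I nu -> (k <= nu)%N ->
        opt I <> wor I ->
        rho R nu q k <= avg_differential_ratio I,
      forall (I : instance R q k) (nu : nat),
        csp_over (@family_E R q) I ->
        is_strong_chromatic_number I nu -> (k <= nu)%N ->
        opt I <> wor I ->
        rho_E R nu q k <= avg_differential_ratio I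
    & forall (I : instance R q k) (nu : nat),
        csp_over (@family_I R q t) I ->
        is_strong_chromatic_number I nu -> (k <= nu)%N ->
        opt I <> wor I ->
        rho R (nu - t) q (minn k (nu - t)) <= avg_differential_ratio I].
Proof.
split=> [I nu chi k_le ne | I nu IE chi k_le ne | I nu II chi k_le ne].
- have := @ratio_ge_rho R q k I hq ne nu nu 0 chi.
  rewrite addn0 (minn_idPl k_le); apply=> // i B.
  by rewrite leqn0 => /eqP/cards0_eq ->; exact: balanced_on0.
- exact: ratio_ge_rho_E (ltnW hk) IE chi k_le.
- apply: (ratio_ge_rho hq ne chi) (_ : (nu <= nu - t + t)%N) _.
    by rewrite addnC -leq_subLR.
  by move=> i B; exact: balanced_family_I (II i).
Qed.
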